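(* Let $a\ge1$. Then: (1) For any two permutations $\nu,\nu'$ of $[a]$, $\mathcal{T}_\nu$ and $\mathcal{T}_{\nu'}$ acting on $J(\mathcal{L}_a)$ have the same orbit structure (the same multiset of orbit sizes). (2) For $1\le j\le a$ let $s_j(I)=\#\{i\in[a]: |C_i(I)|=j\}$. For every permutation $\nu$ of $[a]$ and every $1\le j\le a$, $s_j$ is homomesic for $\mathcal{T}_\nu$ on $J(\mathcal{L}_a)$, and its average along every orbit is the same for all $j$ (namely $1/2$). Consequently every real linear combination of the $s_j$ is homomesic for $\mathcal{T}_\nu$ on $J(\mathcal{L}_a)$.
   Context: For a finite poset $P$, $J(P)$ is the set of order ideals (down-closed subsets) of $P$. For $x\in P$, the toggle $\sigma_x:J(P)\to J(P)$ is $\sigma_x(I)=I\cup\{x\}$ if $x\notin I$ and $I\cup\{x\}\in J(P)$; $\sigma_x(I)=I\setminus\{x\}$ if $x\in I$ and $I\setminus\{x\}\in J(P)$; $\sigma_x(I)=I$ otherwise. For a chain $C=\{x_1<\dots<x_m\}$ in $P$, $\sigma_C=\sigma_{x_1}\circ\cdots\circ\sigma_{x_m}$ (largest element toggled first). $\mathcal{L}_a=\{(i,j)\in[a]\times[a]: i\le j\}$ with the order $(i_1,j_1)\le(i_2,j_2)$ iff $i_1\le i_2$ and $j_1\le j_2$; its columns are $C_c=\{(c,j): c\le j\le a\}$ for $c\in[a]$, and $C_c(I)=C_c\cap I$. For a permutation $\nu$ of $[a]$, comotion is $\mathcal{T}_\nu=\sigma_{C_{\nu(a)}}\circ\cdots\circ\sigma_{C_{\nu(1)}}$.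 A function $f$ on a finite set with a permutation $\tau$ is homomesic if its average over every $\tau$-orbit is the same constant. *)

(* Defs.v *)
From HB Require Import structures.
From mathcomp Require Import all_boot all_order all_fingroup all_algebra.
Set Implicit Arguments. Unset Strict Implicit. Unset Printing Implicit Defensive.
Import Order.TTheory GRing.Theory Num.Theory.

(* Convention: [a] = {1..a} is represented 0-based by 'I_a.
   A point (i,j) of L_a is a pair p : 'I_a * 'I_a with p.1 <= p.2. *)
Definition Pt (a : nat) := ('I_a * 'I_a)%type.

Definition inL a (p : Pt a) : bool := (p.1 <= p.2)%N.
Definition leL a (p q : Pt a) : bool := (p.1 <= q.1)%N && (p.2 <= q.2)%N.

Definition is_ideal a (I : {set Pt a}) : bool :=
  (I \subset [set p | inL p]) &&
  [forall p in I, forall q : Pt a, (inL q && leL q p) ==> (q \in I)].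

Definition J (a : nat) := {I : {set Pt a} | is_ideal I}.

Definition toggle_set a (x : Pt a) (I : {set Pt a}) : {set Pt a} :=
  if x \notin I then (if is_ideal (x |: I) then x |: I else I)
  else (if is_ideal (I :\ x) then I :\ x else I).

Lemma toggle_set_ideal a (x : Pt a) (I : {set Pt a}) :
  is_ideal I -> is_ideal (toggle_set x I).
Proof.
move=> HI; rewrite /toggle_set.
by case: (x \in I) => /=; [case: ifP | case: ifP].
Qed.

Definition toggle a (x : Pt a) (I : J a) : J a :=
  exist _ (toggle_set x (val I)) (toggle_set_ideal x (valP I)).

Definition column a (c : 'I_a) : seq (Pt a) :=
  [seq ((c, j) : Pt a) | j : 'I_a <- enum 'I_a & (c <= j)%N].

(* sigma_C = sigma_{x1} o ... o sigma_{xm}  (largest element toggled first) *)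
Definition toggle_chain a (C : seq (Pt a)) : J a -> J a :=
  foldr (fun x g => toggle x \o g) id C.

Definition comotion a (nu : {perm 'I_a}) : J a -> J a :=
  foldr (fun c g => g \o toggle_chain (column c)) id [seq nu i | i <- enum 'I_a].

(* orbits of f : T -> T (f a bijection) *)
Definition orbit_of (T : finType) (f : T -> T) (x : T) : {set T} :=
  [set y | fconnect f x y].
Definition orbit_set (T : finType) (f : T -> T) : {set {set T}} :=
  [set orbit_of f x | x : T].
(* the multiset of orbit sizes, as a sequence (compare with perm_eq) *)
Definition orbit_sizes (T : finType) (f : T -> T) : seq nat :=
  map (fun O : {set T} => #|O|) (enum (orbit_set f)).

Local Open Scope ring_scope.

Definition orbit_avg (T : finType) (R : numFieldType) (f : T -> T) (g : T -> R)
  (x : T) : R :=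
  (\sum_(y in orbit_of f x) g y) / (#|orbit_of f x|)%:R.

Definition homomesic (T : finType) (R : numFieldType) (f : T -> T) (g : T -> R) :=
  exists c : R, forall x : T, orbit_avg f g x = c.

Definition colI a (i : 'I_a) (I : J a) : {set Pt a} :=
  [set p in val I | p.1 == i].
Definition s_stat a (j : nat) (I : J a) : nat :=
  #|[set i : 'I_a | #|colI i I| == j]|.

(* Main.v *)
Require Import Defs.
From mathcomp Require Import all_boot all_order all_fingroup all_algebra.
From mathcomp Require Import zify.
Set Implicit Arguments. Unset Strict Implicit. Unset Printing Implicit Defensive.
Import Order.TTheory GRing.Theory Num.Theory.

(* An order ideal of L_a is determined by its column heights, which strictly
   decrease until they vanish; so it amounts to a subset S of [a], and s_j is
   the indicator of j in S. Toggling a column moves its height cyclically in the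
   interval allowed by its two neighbours; in particular column toggles at
   distance at least 2 commute. Hence, cutting the columns into those left and
   right of a given place, every comotion can be brought to the one with the
   left columns first by commutations and one exchange u v -> v u. The exchange
   conjugates the map and only shifts in time what each column shows, so orbit
   sizes and orbit sums of s_j are kept. Cutting everywhere reduces to the
   comotion processing the columns from left to right. That one rotates the
   indicator word of S by one place, negating the letter that wraps around; its
   a-th power is complementation of S, so each s_j has average 1/2. *)

Local Open Scope nat_scope.

(** * Encoding an order ideal by its column heights *)

Section Heights.
Variable a : nat.
Implicit Types (I K : J a) (p q x : Pt a).

Definition height I (k : nat) : nat := #|[set p in val I | p.1 == k :> nat]|.

Lemma ideal_inL I p : p \in val I -> p.1 <= p.2.
Proof. by case/andP: (valP I) => /subsetP sI _ /sI; rewrite inE. Qed.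

Lemma ideal_down I p q :
  p \in val I -> q.1 <= q.2 -> q.1 <= p.1 -> q.2 <= p.2 -> q \in val I.
Proof.
move=> pI q12 q1 q2; case/andP: (valP I) => _ /forall_inP/(_ p pI)/forallP/(_ q).
by rewrite /inL /leL q12 q1 q2.
Qed.

Lemma card_ord_interval (c m : nat) :
  c + m <= a -> #|[set j : 'I_a | c <= j < c + m]| = m.
Proof.
move=> cma; have lt_a (i : 'I_m) : c + i < a by have := ltn_ord i; lia.
rewrite -[RHS]card_ord -(@card_imset _ _ (fun i : 'I_m => Ordinal (lt_a i))).
  apply: eq_card => j; rewrite inE; apply/idP/imsetP => [/andP[cj jm]|[i _ ->] /=].
    have jcm : j - c < m by lia.
    by exists (Ordinal jcm) => //; apply: val_inj => /=; lia.
  by have := ltn_ord i; lia.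
by move=> i j [] /addnI/val_inj.
Qed.

(** Downward closure makes each column of an ideal an initial segment starting at the diagonal
    point, so its cardinality locates its end. *)
Lemma mem_height I p : (p \in val I) = (p.1 <= p.2 < p.1 + height I p.1).
Proof.
case: p => c j /=.
(* [P m] holds when the place [c + m] is missing from the ideal, also when it lies outside the grid;
   the least such [m] turns out to be the height. *)
pose P m := [forall j : 'I_a, (j == c + m :> nat) ==> ((c, j) \notin val I)].
have exP : exists m, P m.
  by exists a; apply/forallP => i; apply/implyP => /eqP ia; have := ltn_ord i; lia.
case: (ex_minnP exP) => m Pm min_m.
have ltm k : k < m -> exists2 i : 'I_a, i = c + k :> nat & (c, i) \in val I.
  move=> km; have: ~~ P k by apply/negP => /min_m; lia.
  by case/forallPn => i; rewrite negb_imply negbK => /andP[/eqP]; exists i.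
have cma : c + m <= a.
  case: m ltm {Pm min_m} => [|m] ltm; first by have := ltn_ord c; lia.
  by have [i ? _] := ltm m (ltnSn m); have := ltn_ord i; lia.
have memI (i : 'I_a) : ((c, i) \in val I) = (c <= i < c + m).
  apply/idP/idP => [iI|/andP[ci im]].
    have /= ci := ideal_inL iI; rewrite ci ltnNge; apply/negP => mi.
    have ltia : c + m < a by have := ltn_ord i; lia.
    have /forallP/(_ (Ordinal ltia)) := Pm; rewrite eqxx /= => /negP; apply.
    by apply: (ideal_down iI) => //=; lia.
  have [k km kI] := ltm (i - c) ltac:(lia).
  by have -> : i = k by apply: val_inj => /=; lia.
rewrite memI; congr (_ <= _ < _ + _).
rewrite -(card_ord_interval cma) -(@card_imset _ _ (pair c)) => [|i k [] //].
apply: eq_card => -[d i]; rewrite inE /=; apply/imsetP/andP => [[k]|[iI /eqP]].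
  by rewrite inE -memI => kI [-> ->].
by move/val_inj=> dc; subst d; exists i => //; rewrite inE -memI.
Qed.

Lemma height_inj I K : height I =1 height K -> I = K.
Proof. by move=> eqh; apply/val_inj/setP => p; rewrite !mem_height eqh. Qed.

Lemma height_out I k : a <= k -> height I k = 0.
Proof.
move=> ak; apply: eq_card0 => p; rewrite inE; apply/andP => -[_ /eqP pk].
by have := ltn_ord p.1; lia.
Qed.

Lemma height_le I k : k <= a -> k + height I k <= a.
Proof.
rewrite leq_eqVlt => /orP[/eqP ->|ka]; first by rewrite height_out ?addn0.
suff: height I k <= #|[set j : 'I_a | k <= j < k + (a - k)]|.
  by rewrite card_ord_interval; lia.
have /card_imset <- : injective (pair (Ordinal ka) : 'I_a -> Pt a) by move=> i l [].
apply/subset_leq_card/subsetP => -[c j]; rewrite inE /= => /andP[/ideal_inL /= cj /eqP ck].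
apply/imsetP; exists j; first by rewrite inE; have := ltn_ord j; lia.
by congr (_, _); apply: val_inj.
Qed.

(** The top point of column [k.+1] lies above the point of column [k] with the same second
    coordinate, and column [k] starts one place lower. *)
Lemma height_strict I k : 0 < height I k.+1 -> height I k.+1 < height I k.
Proof.
move=> h0; case: (ltnP k.+1 a) => ka; last by rewrite height_out in h0.
have ka' := ltnW ka.
have := height_le I ka' => hle.
have lt_a : k + height I k.+1 < a by lia.
have: (Ordinal ka, Ordinal lt_a) \in val I by rewrite mem_height /=; lia.
move=> /ideal_down -/(_ (Ordinal ka', Ordinal lt_a)) /=.
by rewrite mem_height /= => /(_ _ _ _); lia.
Qed.

(* The bound a + 1 plays the role of a column to the left of the first one, so
   that all columns obey the same rule. *)
Definition xheight I (k : nat) : nat := if k is k'.+1 then height I k' else a.+1.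

(** The predecessor truncates at 0, so an empty left neighbour forces an empty column. *)
Definition col_max I (c : nat) : nat := (xheight I c).-1.

Definition col_min I (c : nat) : nat :=
  if height I c.+1 is h.+1 then h.+2 else 0.

Lemma xheight_strict I k : 0 < xheight I k.+1 -> xheight I k.+1 < xheight I k.
Proof.
case: k => [_ /=|k]; last exact: height_strict.
by have := height_le I (leq0n a); lia.
Qed.

Lemma height_bounds I c : col_min I c <= height I c <= col_max I c.
Proof.
rewrite /col_min /col_max; have := @xheight_strict I c; have := @height_strict I c.
by rewrite /=; case: (height I c.+1) => [|h]; lia.
Qed.

(** The ideal must already contain the points covered by [x]: the one just below it in its column
    and the one beside it in the column to the left. *)
Lemma is_ideal_add I x : x \notin val I -> x.1 <= x.2 ->
  is_ideal (x |: val I) =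
  (x.2 == x.1 + height I x.1 :> nat) && (height I x.1 < col_max I x.1).
Proof.
case: x => c j /= xI cj; apply/idP/andP => [idx|[/eqP jh hU]].
  pose K : J a := exist (fun S : {set Pt a} => is_ideal S) _ idx.
  have xK : (c, j) \in val K by rewrite !inE eqxx.
  have step q : q \in val K -> q != (c, j) -> q \in val I.
    by rewrite !inE => /orP[->|].
  have jh : j = c + height I c :> nat.
    move: xI; rewrite mem_height /= cj /= => xI.
    case: (ltngtP j (c + height I c)) => // [|hj]; first lia.
    have ja : j.-1 < a by have := ltn_ord j; lia.
    have: (c, Ordinal ja) \in val I.
      apply: step; first by apply: (ideal_down xK) => /=; lia.
      by rewrite xpair_eqE -!val_eqE /=; lia.
    by rewrite mem_height /=; lia.
  split; first exact/eqP.
  rewrite /col_max; case: c {xI} cj idx K xK step jh => -[|c] ca /= cj idx K xK step jh.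
    by have := ltn_ord j; rewrite jh /=; lia.
  have: (Ordinal (ltnW ca), j) \in val I.
    apply: step; first by apply: (ideal_down xK) => /=; lia.
    by rewrite xpair_eqE -!val_eqE /=; lia.
  by rewrite mem_height /=; move: jh => /=; lia.
apply/andP; split.
  apply/subsetP => p; rewrite !inE => /orP[/eqP -> //|]; exact: ideal_inL.
apply/forall_inP => p; rewrite !inE => pI; apply/forallP => -[u v]; apply/implyP.
rewrite /inL /leL /= => /and3P[uv q1 q2]; rewrite !inE.
case/orP: pI q1 q2 => [/eqP-> /= uc vj|pI q1 q2]; last first.
  by rewrite (ideal_down pI) ?orbT.
case: eqVneq => //= qx.
case: (ltngtP u c) => [uc'|?|/val_inj uc']; [|lia|].
  case: c cj xI jh hU uc uc' {qx} => -[|c] ca //= cj xI jh hU _ uc'.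
  apply: (@ideal_down _ (Ordinal (ltnW ca), j)) => //=.
  by rewrite mem_height /=; move: hU; rewrite /col_max /=; lia.
subst u; move: qx; rewrite xpair_eqE eqxx mem_height /= -val_eqE /=; lia.
Qed.

(** Dually, the points covering [x], one in its own column and one in the column to the right, must
    be absent. *)
Lemma is_ideal_del I x : x \in val I ->
  is_ideal (val I :\ x) =
  (x.2.+1 == x.1 + height I x.1) && (col_min I x.1 < height I x.1).
Proof.
case: x => c j /= xI; have := xI; rewrite mem_height /= => /andP[cj jh].
apply/idP/andP => [idx|[/eqP jh' hL]].
  pose K : J a := exist (fun S : {set Pt a} => is_ideal S) _ idx.
  have xK : (c, j) \notin val K by rewrite !inE eqxx.
  have step q : q \in val I -> q != (c, j) -> c <= q.1 -> j <= q.2 -> False.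
    move=> qI qx cq jq; case/negP: xK.
    by apply: (@ideal_down K q) => //=; rewrite !inE qx.
  have jh' : j.+1 = c + height I c.
    apply/eqP; rewrite eqn_leq jh /= leqNgt; apply/negP => hj.
    have ja : j.+1 < a by have := height_le I (ltnW (ltn_ord c)); lia.
    apply: (step (c, Ordinal ja)) => //=; first by rewrite mem_height /=; lia.
    by rewrite xpair_eqE -!val_eqE /=; lia.
  split; first exact/eqP.
  rewrite /col_min; case E : (height I c.+1) => [|h]; first lia.
  have := @height_strict I c; rewrite E => /(_ isT) hs.
  rewrite ltn_neqAle; apply/andP; split; last lia.
  apply/negP => /eqP hh.
  have ca : c.+1 < a by rewrite ltnNge; apply/negP => /(height_out I); lia.
  apply: (step (Ordinal ca, j)) => //=; first by rewrite mem_height /=; lia.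
  by rewrite xpair_eqE -!val_eqE /=; lia.
apply/andP; split.
  by apply/subsetP => p; rewrite !inE => /andP[_]; exact: ideal_inL.
apply/forall_inP => -[u v]; rewrite !inE => /andP[px pI]; apply/forallP => q.
apply/implyP; rewrite /inL /leL /= => /and3P[q12 q1 q2].
rewrite !inE (@ideal_down _ _ q pI) // andbT.
apply/eqP => qx; subst q; rewrite /= in q12 q1 q2.
have := pI; rewrite mem_height /= => /andP[uv uh].
case: (ltngtP c u) => [cu|?|/val_inj cu]; [|lia|].
  have ca : c.+1 < a by have := ltn_ord u; lia.
  have: (Ordinal ca, v) \in val I by apply: (ideal_down pI) => /=; lia.
  rewrite mem_height /=; move: hL; rewrite /col_min.
  by case: (height I c.+1) => [|h]; lia.
by subst u; move: px; rewrite xpair_eqE eqxx -val_eqE /=; lia.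
Qed.

(** * Effect of point toggles and column toggles on heights *)

Lemma toggle_height_other x I k : x.1 != k :> nat ->
  height (toggle x I) k = height I k.
Proof.
move=> xk; apply: eq_card => p; rewrite !inE /= /toggle_set.
have [->|px] := eqVneq p x; first by rewrite (negPf xk) !andbF.
by congr (_ && _); do 2!case: ifP => _; rewrite ?inE ?(negPf px).
Qed.

Definition toggle_nat (lo hi c j h : nat) : nat :=
  if (j == c + h) && (h < hi) then h.+1
  else if (j.+1 == c + h) && (lo < h) then h.-1 else h.

Lemma toggle_height x I : x.1 <= x.2 ->
  height (toggle x I) x.1 =
  toggle_nat (col_min I x.1) (col_max I x.1) x.1 x.2 (height I x.1).
Proof.
move=> x12; rewrite /toggle_nat {1}/height /= /toggle_set.
case: (boolP (x \in val I)) => xI /=; last first.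
  rewrite is_ideal_add //; move: (xI); rewrite mem_height x12 /= => hx.
  case: ifP => _.
    rewrite (_ : [set _ in _ | _] = x |: [set p in val I | p.1 == x.1 :> nat]).
      by rewrite cardsU1 inE (negPf xI).
    by apply/setP => p; rewrite !inE; case: eqVneq => [->|_] //=; rewrite eqxx.
  by case: ifP => // /andP[/eqP]; rewrite -/(height I x.1); lia.
rewrite is_ideal_del //; move: (xI); rewrite mem_height x12 /= => hx.
have -> : (x.2 == x.1 + height I x.1 :> nat) = false by lia.
case: ifP => _ //=.
rewrite (_ : [set _ in _ | _] = [set p in val I | p.1 == x.1 :> nat] :\ x).
  by rewrite /height (cardsD1 x [set p in val I | _]) inE xI eqxx.
by apply/setP => p; rewrite !inE andbA.
Qed.

(** Places are toggled from the top down. A column below [hi] gains a point at its first free place,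
    after which lower toggles do nothing; a column at [hi] loses its top point again and again until
    it reaches [lo]. The general start [i] serves the induction. *)
Lemma foldr_toggle_nat lo hi c h n i :
  lo <= h <= hi -> c <= i -> i + n = a -> c + hi <= a ->
  foldr (toggle_nat lo hi c) h (iota i n) =
  if h < hi then (if i <= c + h then h.+1 else h)
  else (if i < c + h then maxn lo (i - c) else h).
Proof.
move=> lhh; elim: n i => [|n IHn] i ci ina ca /=.
  by do 2!case: ifP; lia.
rewrite IHn; [|lia..]; rewrite /toggle_nat.
repeat case: ifP; lia.
Qed.

Lemma columnE (c : 'I_a) : map (fun p : Pt a => val p.2) (column c) = iota c (a - c).
Proof.
rewrite -map_comp (eq_map (g := val)) // -(filter_map val (fun j => c <= j)) val_enum_ord.
have -> : iota 0 a = iota 0 c ++ iota c (a - c).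
  by rewrite -{2}[val c]add0n -iotaD subnKC // ltnW.
rewrite filter_cat.
rewrite (eq_in_filter (a2 := pred0)) => [|i]; last by rewrite mem_iota /=; lia.
rewrite filter_pred0 /= (eq_in_filter (a2 := predT)) ?filter_predT // => i.
by rewrite mem_iota /=; lia.
Qed.

Definition col_toggle (c : 'I_a) : J a -> J a := toggle_chain (column c).

Lemma mem_column (c : 'I_a) x : x \in column c -> x.1 = c /\ c <= x.2.
Proof. by case/mapP => j; rewrite mem_filter => /andP[cj _] ->. Qed.

Lemma toggle_chain_height_other (s : seq (Pt a)) I (k : nat) :
  (forall x, x \in s -> x.1 != k :> nat) -> height (toggle_chain s I) k = height I k.
Proof.
elim: s => //= x s IHs Hs; rewrite toggle_height_other; last exact/Hs/mem_head.
by apply: IHs => y ys; apply: Hs; rewrite inE ys orbT.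
Qed.

Lemma col_toggle_other (c : 'I_a) I (k : nat) : c != k :> nat ->
  height (col_toggle c I) k = height I k.
Proof.
by move=> ck; apply: toggle_chain_height_other => x /mem_column[-> _].
Qed.

Lemma col_toggle_height (c : 'I_a) I :
  height (col_toggle c I) c =
  if height I c < col_max I c then (height I c).+1 else col_min I c.
Proof.
have: {subset column c <= column c} by [].
(* Toggles inside column [c] do not move its neighbours, so both bounds stay fixed during the whole
   scan. *)
suff fold_height s : {subset s <= column c} -> height (toggle_chain s I) c =
    foldr (toggle_nat (col_min I c) (col_max I c) c) (height I c)
          (map (fun p : Pt a => val p.2) s).
  move/fold_height; rewrite columnE => ->.
  have := height_bounds I c; have := ltn_ord c => ca hb.
  rewrite foldr_toggle_nat ?leqnn //; [|lia|]; last first.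
    rewrite /col_max; case: c ca {hb fold_height} => -[|c] ca _ /=; first lia.
    by have := height_le I (ltnW (ltnW ca)); lia.
  rewrite leq_addr; case: ifP => // _; rewrite subnn maxn0.
  by case: ifP => //; move: hb; case: (height I c) => [|h]; lia.
elim: s => //= x s IHs sub; have [xc xj] := mem_column (sub x (mem_head _ _)).
have subs : {subset s <= column c} by move=> y ys; apply: sub; rewrite inE ys orbT.
have other k : c != k :> nat -> height (toggle_chain s I) k = height I k.
  by move=> ck; apply: toggle_chain_height_other => y /subs/mem_column[-> _].
rewrite -{1}xc toggle_height ?xc // IHs //.
have -> : col_min (toggle_chain s I) c = col_min I c.
  by rewrite /col_min other //; lia.
congr (toggle_nat _ _); rewrite /col_max; case: (c : nat) other => //= k other.
by rewrite other //; lia.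
Qed.

Lemma toggle_inj x : injective (toggle x).
Proof.
apply: (can_inj (g := toggle x)) => I; apply: val_inj => /=; rewrite /toggle_set.
case: (boolP (x \in sval I)) => xI /=.
  case: (boolP (is_ideal (sval I :\ x))) => idx; last by rewrite xI /= (negPf idx).
  by rewrite !inE eqxx /= setD1K // (valP I).
case: (boolP (is_ideal (x |: sval I))) => idx; last by rewrite xI (negPf idx).
by rewrite !inE eqxx /= setU1K // (valP I).
Qed.

Lemma col_toggle_inj (c : 'I_a) : injective (col_toggle c).
Proof.
rewrite /col_toggle; elim: (column c) => [|x s IHs] //=.
exact: inj_comp (@toggle_inj x) IHs.
Qed.

End Heights.

(** * Orbits, orbit sums and conjugation *)

Section Orbits.
Variable T : finType.
Implicit Types (f g phi : T -> T).

Lemma sum_orbit_comp f (F : T -> nat) y : injective f ->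
  \sum_(z in orbit_of f y) F (f z) = \sum_(z in orbit_of f y) F z.
Proof.
move=> injf; rewrite [RHS](reindex_inj injf); apply: eq_bigl => z.
by rewrite !inE -same_fconnect1_r.
Qed.

Lemma sum_orbit_iter f (F : T -> nat) n y : injective f ->
  \sum_(z in orbit_of f y) F (iter n f z) = \sum_(z in orbit_of f y) F z.
Proof.
move=> injf; elim: n => // n <-; under eq_bigr do rewrite iterSr.
exact: (sum_orbit_comp (fun z => F (iter n f z))).
Qed.

Lemma eq_orbit_of f g y : f =1 g -> orbit_of f y = orbit_of g y.
Proof. by move=> fg; apply/setP => z; rewrite !inE (eq_fconnect fg). Qed.

Lemma orbit_of_semiconj f g phi y : injective phi ->
  (forall z, phi (f z) = g (phi z)) -> orbit_of g (phi y) = phi @: orbit_of f y.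
Proof.
move=> injphi fg.
have iterE n z : phi (iter n f z) = iter n g (phi z).
  by elim: n => //= n <-.
apply/setP => z; rewrite inE; apply/idP/imsetP => [/iter_findex <-|[x]].
  by rewrite -iterE; eexists; last reflexivity; rewrite inE fconnect_iter.
by rewrite inE => /iter_findex <- ->; rewrite iterE fconnect_iter.
Qed.

Lemma orbit_sizes_semiconj f g phi : injective phi ->
  (forall z, phi (f z) = g (phi z)) -> perm_eq (orbit_sizes f) (orbit_sizes g).
Proof.
move=> injphi fg; have injim := imset_inj injphi.
have surj z : exists x, z = phi x.
  by exists (invF injphi z); rewrite f_invF.
have -> : orbit_sizes f = map (fun O : {set T} => #|O|)
    (map (fun O : {set T} => phi @: O) (enum (orbit_set f))).
  by rewrite -map_comp; apply: eq_map => O /=; rewrite card_imset.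
apply: perm_map; apply: uniq_perm; rewrite ?map_inj_uniq ?enum_uniq // => O.
rewrite mem_enum; apply/mapP/imsetP => [[O']|[x _ ->]].
  rewrite mem_enum => /imsetP[x _ ->] ->; exists (phi x) => //.
  by rewrite (orbit_of_semiconj _ injphi fg).
have [y ->] := surj x; exists (orbit_of f y); last exact: orbit_of_semiconj.
by rewrite mem_enum imset_f.
Qed.

End Orbits.

(** * Words of column toggles and their reduction to the left-to-right word *)

Section Words.
Variable a : nat.
Implicit Types (I K : J a) (f g u x : J a -> J a) (w s : seq 'I_a).

Lemma s_statE j I : s_stat j I = \sum_(i < a) (height I i == j).
Proof.
rewrite /s_stat -sum1dep_card big_mkcond /=; apply: eq_bigr => i _.
suff -> : #|colI i I| = height I i by case: eqP.
by apply: eq_card => p; rewrite !inE.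
Qed.

(** A conjugacy that may change each [s_stat j] pointwise and only has to keep its orbit sums; this
    is what an exchange of two factors provides. *)
Definition orbit_equiv f g := exists phi : J a -> J a,
  [/\ injective phi, forall I, phi (f I) = g (phi I) &
      forall j I, \sum_(K in orbit_of g (phi I)) s_stat j K =
                  \sum_(K in orbit_of f I) s_stat j K].

Lemma orbit_equiv_refl f : orbit_equiv f f.
Proof. by exists id; split=> // I K. Qed.

Lemma orbit_equiv_eq f g h : f =1 g -> orbit_equiv g h -> orbit_equiv f h.
Proof.
move=> fg [phi [injphi gh sums]]; exists phi; split=> [|I|j I].
- exact: injphi.
- by rewrite fg gh.
by rewrite (eq_orbit_of I fg) -sums.
Qed.

Lemma orbit_equiv_trans f g h :
  orbit_equiv f g -> orbit_equiv g h -> orbit_equiv f h.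
Proof.
move=> [phi [iphi fg sfg]] [psi [ipsi gh sgh]]; exists (psi \o phi).
split=> [|I|j I].
- exact: inj_comp.
- by rewrite -gh -fg.
by rewrite -sfg -sgh.
Qed.

(* Along an orbit of [x \o u], a column fixed by [x] is seen after [u] with the
   values it takes one full step later. *)
Lemma orbit_equiv_comm x u : injective x -> injective u ->
  (forall k : 'I_a, (forall I, height (x I) k = height I k) \/
                    (forall I, height (u I) k = height I k)) ->
  orbit_equiv (x \o u) (u \o x).
Proof.
move=> injx inju fixed; exists u; split=> // j I.
rewrite (@orbit_of_semiconj _ (x \o u) (u \o x)) // big_imset => [|? ? _ _ /inju//] /=.
(* Each statistic is a sum over columns, so the orbit sums are compared one column at a time. *)
rewrite (eq_bigr _ (fun K _ => s_statE j (u K))) exchange_big /=.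
rewrite (eq_bigr _ (fun K _ => s_statE j K)) [RHS]exchange_big /=.
apply: eq_bigr => k _; case: (fixed k) => fixk; last first.
  by apply: eq_bigr => K _; rewrite fixk.
rewrite -[RHS](@sum_orbit_comp _ (x \o u)) /=; last exact: inj_comp.
by apply: eq_bigr => K _; rewrite fixk.
Qed.

Definition toggle_word w : J a -> J a := foldr (fun c g => g \o col_toggle c) id w.

Lemma toggle_word_cat s w I : toggle_word (s ++ w) I = toggle_word w (toggle_word s I).
Proof. by elim: s I => //= c s IHs I; rewrite IHs. Qed.

Lemma toggle_word_inj w : injective (toggle_word w).
Proof. by elim: w => //= c w IHw; apply: inj_comp IHw (@col_toggle_inj _ c). Qed.

Lemma toggle_word_height_notin w (k : 'I_a) I :
  k \notin w -> height (toggle_word w I) k = height I k.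
Proof.
elim: w I => //= c w IHw I; rewrite inE negb_or => /andP[kc kw].
by rewrite IHw // col_toggle_other // eq_sym.
Qed.

Definition far (c d : nat) := (c.+1 < d) || (d.+1 < c).

(** A column toggle changes only its own height and reads only that height and those of its two
    neighbours. *)
Lemma col_toggleC (c d : 'I_a) I : far c d ->
  col_toggle c (col_toggle d I) = col_toggle d (col_toggle c I).
Proof.
move=> fcd; apply: height_inj => k.
have indep (c' d' : 'I_a) K : far c' d' -> height (col_toggle c' (col_toggle d' K)) c' =
    height (col_toggle c' K) c'.
  move=> f'; rewrite !col_toggle_height.
  have e (i : nat) : d' != i :> nat -> height (col_toggle d' K) i = height K i.
    exact: col_toggle_other.
  rewrite /col_max /col_min !e; [|move: f'; rewrite /far; lia..].
  case: (c' : nat) f' => //= n f'; rewrite e //; move: f'; rewrite /far; lia.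
have [ck|ck] := eqVneq (c : nat) k.
  rewrite -ck indep // [RHS]col_toggle_other //; move: fcd; rewrite /far; lia.
rewrite (col_toggle_other _ ck).
have [dk|dk] := eqVneq (d : nat) k.
  by rewrite -dk indep // /far orbC.
by rewrite !col_toggle_other.
Qed.

Lemma toggle_word_toggleC w (c : 'I_a) I : {in w, forall d : 'I_a, far c d} ->
  toggle_word w (col_toggle c I) = col_toggle c (toggle_word w I).
Proof.
elim: w I => //= d w IHw I Hw; rewrite -col_toggleC; last exact/Hw/mem_head.
by apply: IHw => e ew; apply: Hw; rewrite inE ew orbT.
Qed.

(** Moving the [P]-letters to the front only exchanges a letter outside [P] with a later letter in
    [P], and such pairs commute. *)
Lemma toggle_word_sort (P : pred 'I_a) w I :
  pairwise (fun c d => ~~ P c ==> P d ==> far c d) w ->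
  toggle_word w I = toggle_word (filter P w ++ filter (predC P) w) I.
Proof.
elim: w I => //= c w IHw I /andP[/allP cw /IHw {}IHw].
rewrite IHw; case: ifP => Pc /=; rewrite ?Pc //= !toggle_word_cat /=.
rewrite toggle_word_toggleC // => d; rewrite mem_filter => /andP[Pd dw].
by have := cw d dw; rewrite Pc Pd.
Qed.

(** Each letter has a single position, so [c] and [d] cannot occur in both orders. *)
Lemma uniq_pairwise_or w (c d : 'I_a) : uniq w ->
  pairwise (fun e f : 'I_a => (e, f) != (c, d)) w \/
  pairwise (fun e f : 'I_a => (e, f) != (d, c)) w.
Proof.
move=> uw.
have pw (u v : 'I_a) : ~~ (index u w < index v w) ->
    pairwise (fun e f : 'I_a => (e, f) != (u, v)) w.
  move=> uv; apply/(pairwiseP u) => i j; rewrite !inE => iw jw ij.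
  by apply: contraNneq uv => -[<- <-]; rewrite !index_uniq.
by case: (ltnP (index c w) (index d w)) => cd; [right|left]; apply: pw; lia.
Qed.

(* Only the two columns adjacent to the cut fail to commute across it; according
   to which one comes first, the cut is reached by commutations alone or by
   commutations followed by a rotation. *)
Lemma toggle_word_split w k : uniq w ->
  orbit_equiv (toggle_word w)
    (toggle_word ([seq c : 'I_a <- w | c < k] ++ [seq c : 'I_a <- w | k <= c])).
Proof.
move=> uw; set lo := [seq c : 'I_a <- w | c < k].
set hi := [seq c : 'I_a <- w | k <= c].
have hiE : filter (predC (fun c : 'I_a => c < k)) w = hi.
  by apply: eq_filter => c /=; rewrite -leqNgt.
have loE : filter (predC (fun c : 'I_a => k <= c)) w = lo.
  by apply: eq_filter => c /=; rewrite -ltnNge.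
have split1 : pairwise (fun c d : 'I_a => ~~ ((c == k :> nat) && (d.+1 == k))) w ->
    orbit_equiv (toggle_word w) (toggle_word (lo ++ hi)).
  move=> pw; apply: orbit_equiv_eq (orbit_equiv_refl _) => I.
  rewrite -hiE; apply: toggle_word_sort; apply: sub_pairwise pw => c d.
  by rewrite /far; lia.
have split2 : pairwise (fun c d : 'I_a => ~~ ((d == k :> nat) && (c.+1 == k))) w ->
    orbit_equiv (toggle_word w) (toggle_word (lo ++ hi)).
  move=> pw; apply: (@orbit_equiv_eq _ (toggle_word lo \o toggle_word hi)) => [I|].
    rewrite /= -toggle_word_cat -loE; apply: toggle_word_sort; apply: sub_pairwise pw => c d.
    by rewrite /far; lia.
  apply: orbit_equiv_trans (orbit_equiv_eq _ (orbit_equiv_refl _)); last first.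
    by move=> I; rewrite toggle_word_cat.
  (* Columns left of the cut are untouched by [hi], the others by [lo]. *)
  apply: orbit_equiv_comm; [exact: toggle_word_inj..|] => c.
  case: (ltnP c k) => ck; [right|left] => I; apply: toggle_word_height_notin;
    by rewrite mem_filter; lia.
(* For a cut at either end of the range, no pair of adjacent columns straddles it. *)
case: (ltnP k a) => ka; last first.
  apply: split1; elim: (w) => //= c s ->; rewrite andbT; apply/allP => d _.
  by have := ltn_ord c; lia.
case: k ka @lo @hi hiE loE split1 split2 => [|k] ka lo hi hiE loE split1 split2.
  by apply: split1; elim: (w) => //= c s ->; rewrite andbT; apply/allP => d _; lia.
have [pw|pw] := uniq_pairwise_or (Ordinal ka) (Ordinal (ltnW ka)) uw.
  apply: split1; apply: sub_pairwise pw => c d; rewrite xpair_eqE -!val_eqE /=; lia.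
apply: split2; apply: sub_pairwise pw => c d; rewrite xpair_eqE -!val_eqE /=; lia.
Qed.

Lemma toggle_word_enum w : perm_eq w (enum 'I_a) ->
  orbit_equiv (toggle_word w) (toggle_word (enum 'I_a)).
Proof.
move=> wperm.
(* Invariant after cutting at 1, ..., [k]: the columns below [k] come first, in increasing order. *)
suff sorted_upto k : exists v, [/\ perm_eq v w, orbit_equiv (toggle_word w) (toggle_word v) &
    pairwise (fun c d : 'I_a => (c < d) || (k <= c) && (k <= d)) v].
  have [v [vw wv pv]] := sorted_upto a.
  suff <- : v = enum 'I_a by [].
  apply: (@irr_sorted_eq _ (fun c d : 'I_a => c < d)).
  - by move=> ? ? ?; apply: ltn_trans.
  - by move=> ?; apply: ltnn.
  - rewrite sorted_pairwise; last by move=> ? ? ?; apply: ltn_trans.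
    by apply: sub_pairwise pv => c d; have := ltn_ord c; lia.
  - by have := iota_ltn_sorted 0 a; rewrite -val_enum_ord sorted_map.
  by apply: perm_mem; apply: perm_trans vw wperm.
elim: k => [|k [v [vw wv pv]]].
  exists w; split=> //; first exact: orbit_equiv_refl.
  by elim: (w) => //= c s ->; rewrite andbT; apply/allP => d _; rewrite orbT.
have uv : uniq v by rewrite (perm_uniq vw) (perm_uniq wperm) enum_uniq.
exists ([seq c : 'I_a <- v | c < k.+1] ++ [seq c : 'I_a <- v | k.+1 <= c]); split.
- apply: perm_trans vw.
  have -> : [seq c : 'I_a <- v | k < c] = filter (predC (fun c : 'I_a => c < k.+1)) v.
    by apply: eq_filter => c /=; rewrite -leqNgt.
  by rewrite perm_filterC.
- exact: orbit_equiv_trans wv (toggle_word_split _ uv).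
rewrite pairwise_cat; apply/and3P; split.
- apply/allrelP => c d; rewrite !mem_filter; lia.
(* In the left half, two columns that are both at least [k] would both equal [k], which uniqueness
   excludes. *)
- rewrite uniq_pairwise in uv; have := conj uv pv.
  move/andP; rewrite -pairwise_relI => /(pairwise_filter (fun c : 'I_a => c < k.+1)).
  apply: sub_in_pairwise (filter_all _ _) => c d; rewrite -!topredE /= -val_eqE /=; lia.
apply: (@sub_in_pairwise _ _ (fun _ _ => true) _ _ _ (filter_all _ _)).
  by move=> c d; rewrite -!topredE /= => -> ->; rewrite orbT.
by elim: [seq _ <- v | _] => //= c s ->; rewrite all_predT.
Qed.

End Words.

(** * The left-to-right comotion as a rotation with negation *)

Section Promotion.
Variable a : nat.
Implicit Types (I K : J a).

Lemma height_decr I i k : i < k -> 0 < height I k -> height I k < height I i.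
Proof.
elim: k => // k IHk; rewrite ltnS leq_eqVlt => /orP[/eqP ->|ik] hk.
  exact: height_strict.
by have := height_strict hk; have := IHk ik; lia.
Qed.

(** For [0 < j] this is the letter at [j] of the indicator word of the subset S. *)
Definition has_height I j := [exists i : 'I_a, height I i == j].

(** Positive heights strictly decrease, so no two columns share one. *)
Lemma s_stat_has_height j I : 0 < j -> s_stat j I = has_height I j.
Proof.
move=> j0; rewrite s_statE /has_height.
case: (boolP [exists i, _]) => [/existsP[i /eqP hi]|noi]; last first.
  by rewrite big1 // => i _; case: eqP => // hi; case/existsP: noi; exists i; apply/eqP.
rewrite (bigD1 i) //= hi eqxx big1 // => k ki; case: eqP => // hk.
move: ki; rewrite -val_eqE /= neq_ltn => /orP[ki|ik].
  by have := @height_decr I _ _ ki; lia.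
by have := @height_decr I _ _ ik; lia.
Qed.

Definition promotion : J a -> J a := toggle_word (enum 'I_a).

(** If the first column is not full, every nonempty column and the first empty one grow by one. If
    it is full, it is discarded: each column takes over its right neighbour, grown by one when
    nonempty. *)
Definition promotion_height I k :=
  if height I 0 < a then (if 0 < xheight I k then (height I k).+1 else 0)
  else col_min I k.

Lemma toggle_word_take_height k I i : k <= a ->
  height (toggle_word (take k (enum 'I_a)) I) i =
  if i < k then promotion_height I i else height I i.
Proof.
elim: k i => [|k IHk] i ka; first by rewrite take0.
rewrite (take_nth (Ordinal ka)) ?size_enum_ord // -cats1 toggle_word_cat /=.
have := nth_ord_enum (Ordinal ka) (Ordinal ka); rewrite /= => ->.
have {}IHk := IHk _ (ltnW ka).
have [ik|ik] := eqVneq i k; last first.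
  rewrite col_toggle_other ?IHk /=; last by rewrite eq_sym.
  by rewrite ltnS [i <= k]leq_eqVlt (negPf ik).
rewrite {}ik ltnSn col_toggle_height /= IHk ltnn.
(* When column [k] is toggled, its right neighbour still has the old height and its left neighbour
   already the new one. *)
rewrite {1}/col_min IHk [k.+1 < k]ltnNge leqW //= -/(col_min I k).
rewrite /col_max /promotion_height.
have h0 := height_le I (leq0n a).
case: k ka IHk => [|k] ka IHk /=; first by rewrite -/(height I 0); case: ifP => //; lia.
rewrite IHk ltnSn /promotion_height.
have := @height_strict _ I k; have := @xheight_strict _ I k.
have := @height_strict _ I k.+1; rewrite /=.
(* If the first column is full, the new left neighbour leaves no room above column [k.+1], which
   therefore falls to its minimum. *)
case: (ltnP (height I 0) a) => _ s1 s2 s3; last first.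
  have -> // : (height I k.+1 < (col_min I k).-1) = false.
  by rewrite /col_min; case: (height I k.+1) => [|h]; lia.
rewrite /col_min; case: (height I k.+2) s1 => [|h] s1;
  by repeat case: ifP; lia.
Qed.

Lemma promotion_heightE I i : i < a -> height (promotion I) i = promotion_height I i.
Proof.
move=> ia; have := @toggle_word_take_height a I i (leqnn a).
by rewrite take_oversize ?size_enum_ord // ia.
Qed.

Lemma height_add_le I k : 0 < height I k -> k + height I k <= height I 0.
Proof. by elim: k => // k IHk hk; have := height_strict hk; have := IHk; lia. Qed.

Lemma has_heightP I j :
  reflect (exists2 i, i < a & height I i = j) (has_height I j).
Proof.
apply: (iffP existsP) => [[i /eqP hi]|[i ia hi]]; first by exists i.
by exists (Ordinal ia); apply/eqP.
Qed.

(** The column of height [j] grows in place, or, if the first column is full, reappears grown one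
    column to the left. *)
Lemma has_height_promotionS I j : 0 < j < a ->
  has_height (promotion I) j.+1 = has_height I j.
Proof.
move=> /andP[j0 ja]; apply/has_heightP/has_heightP => -[i ia].
  rewrite promotion_heightE // /promotion_height; case: ifP => h0.
    by case: ifP => // _ [hi]; exists i.
  rewrite /col_min; case E : (height I i.+1) => [//|h] [hj].
  exists i.+1; last by rewrite E hj.
  by rewrite ltnNge; apply/negP => /(height_out I); rewrite E.
move=> hi; case: (ltnP (height I 0) a) => h0.
  exists i => //; rewrite promotion_heightE // /promotion_height h0.
  have := @xheight_strict _ I i; rewrite /= hi; case: ifP => //; lia.
case: i ia hi => [|i] ia hi; first lia.
exists i; first exact: ltnW.
rewrite promotion_heightE ?(ltnW ia) // /promotion_height ltnNge h0 /=.
by rewrite /col_min hi; case: (j) j0.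
Qed.

(** If the first column is not full, the first empty column acquires height 1; if it is full, every
    new nonzero height is at least 2. *)
Lemma has_height_promotion1 I : 0 < a -> has_height (promotion I) 1 = ~~ has_height I a.
Proof.
move=> a0; case: (ltnP (height I 0) a) => h0.
  have -> : has_height I a = false.
    apply/has_heightP => -[[|i] ia hi]; first lia.
    by have := @height_decr I 0 i.+1 isT; lia.
  have zero : exists i, height I i == 0 by exists a; rewrite height_out.
  case: (ex_minnP zero) => i /eqP hi min_i; apply/has_heightP.
  have ia : i < a.
    (* Otherwise all [a] columns are nonempty, and strict decrease makes the first one full. *)
    rewrite ltnNge; apply/negP => ai; have: ~~ (height I a.-1 == 0).
      by apply/negP => /min_i; lia.
    by rewrite -lt0n => h1; have := height_add_le h1; lia.
  exists i => //; rewrite promotion_heightE // /promotion_height h0 hi.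
  case: i {ia hi} min_i => //= i min_i; case: (posnP (height I i)) => // /eqP/min_i.
  by rewrite ltnn.
have -> : has_height I a.
  by apply/has_heightP; exists 0 => //; have := height_le I (leq0n a); lia.
apply/has_heightP => -[i ia]; rewrite promotion_heightE // /promotion_height ltnNge h0 /=.
by rewrite /col_min; case: (height I i.+1).
Qed.

Lemma has_height_iter_promotion n I j : 0 < j -> j + n <= a ->
  has_height (iter n promotion I) (j + n) = has_height I j.
Proof.
move=> j0; elim: n => [|n IHn] jn; first by rewrite addn0.
by rewrite iterS addnS has_height_promotionS ?IHn; lia.
Qed.

(** The letter at [j] needs [a - j] steps to reach [a], one to wrap to 1 with negation, and [j - 1]
    to return. *)
Lemma has_height_iter_promotion_a I j : 0 < j <= a ->
  has_height (iter a promotion I) j = ~~ has_height I j.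
Proof.
move=> /andP[j0 ja].
have -> : iter a promotion I = iter j.-1 promotion (promotion (iter (a - j) promotion I)).
  by rewrite -iterS -iterD; congr iter; lia.
rewrite -[X in has_height _ X = _](prednK j0) -add1n.
rewrite has_height_iter_promotion //; last lia.
rewrite has_height_promotion1; last lia.
by rewrite -(@has_height_iter_promotion (a - j) I j) ?subnKC.
Qed.

Lemma sum_orbit_promotion I j : 0 < j <= a ->
  (\sum_(K in orbit_of promotion I) s_stat j K) * 2 = #|orbit_of promotion I|.
Proof.
move=> ja; rewrite muln2 -addnn.
(* One copy of the sum is shifted by [a] steps along the orbit; there the indicator is complemented,
   so the two copies add up to 1 at each ideal. *)
rewrite -{1}(sum_orbit_iter (s_stat j) a I (@toggle_word_inj _ _)) -big_split -sum1_card /=.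
apply: eq_bigr => K _; have /andP[j0 _] := ja.
by rewrite !s_stat_has_height // has_height_iter_promotion_a //; case: has_height.
Qed.

End Promotion.

(** * Transfer to arbitrary comotions and the averages *)

Section Comotion.
Variable a : nat.

Lemma comotion_equiv (nu : {perm 'I_a}) : orbit_equiv (comotion nu) (@promotion a).
Proof.
apply: (@toggle_word_enum a [seq nu i | i <- enum 'I_a]); apply: uniq_perm.
- by rewrite map_inj_uniq ?enum_uniq //; apply: perm_inj.
- exact: enum_uniq.
move=> i; rewrite mem_enum; apply/mapP; exists (nu^-1 i)%g; first by rewrite mem_enum.
by rewrite permKV.
Qed.

Lemma sum_orbit_comotion (nu : {perm 'I_a}) I j : 0 < j <= a ->
  (\sum_(K in orbit_of (comotion nu) I) s_stat j K) * 2 = #|orbit_of (comotion nu) I|.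
Proof.
move=> ja; have [phi [injphi conj sums]] := comotion_equiv nu.
rewrite -sums (sum_orbit_promotion _ ja) (orbit_of_semiconj _ injphi conj).
by rewrite card_imset.
Qed.

End Comotion.

Local Open Scope ring_scope.

Lemma orbit_avg_s_stat (a : nat) (R : numFieldType) (nu : {perm 'I_a}) (j : nat) (I : J a) :
  (1 <= j <= a)%N ->
  orbit_avg (comotion nu) (fun K => (s_stat j K)%:R : R) I = 2^-1.
Proof.
move=> ja; rewrite /orbit_avg -natr_sum -(sum_orbit_comotion nu I ja).
set n := (\sum_(K in _) _)%N.
have n0 : n%:R != 0 :> R.
  rewrite pnatr_eq0 -lt0n -(ltn_pmul2r (isT : 0 < 2)%N) mul0n.
  rewrite (sum_orbit_comotion nu I ja); apply/card_gt0P; exists I.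
  by rewrite inE connect0.
by rewrite natrM invfM mulrA divff // mul1r.
Qed.

Theorem mainTheorem3 (a : nat) (ha : (1 <= a)%N) :
  (forall nu nu' : {perm 'I_a},
     perm_eq (orbit_sizes (comotion nu)) (orbit_sizes (comotion nu'))) /\
  (forall (R : realFieldType) (nu : {perm 'I_a}),
     (forall j : nat, (1 <= j <= a)%N ->
        forall I : J a,
          orbit_avg (comotion nu) (fun K => (s_stat j K)%:R : R) I = 2^-1) /\
     (forall c : nat -> R,
        homomesic (comotion nu)
          (fun K => \sum_(1 <= j < a.+1) c j * (s_stat j K)%:R))).
Proof.
split=> [nu nu'|R nu].
  have sizes (mu : {perm 'I_a}) :
      perm_eq (orbit_sizes (comotion mu)) (orbit_sizes (@promotion a)).
    have [phi [injphi conj _]] := comotion_equiv mu.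
    exact: orbit_sizes_semiconj injphi conj.
  by rewrite (permPl (sizes nu)) perm_sym.
split=> [j ja I|c]; first exact: orbit_avg_s_stat.
(* The constant comes from linearity, each statistic averaging 1/2. *)
exists (\sum_(1 <= j < a.+1) c j * 2^-1) => I.
rewrite /orbit_avg exchange_big /= mulr_suml.
apply: eq_big_nat => j ja; rewrite -mulr_sumr -mulrA; congr (_ * _).
exact: orbit_avg_s_stat.
Qed.
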